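(* Let $\beta>1/2$, $m>0$, and let $X$ be a random variable with density $h_{\beta,m}(x)=C_{\beta,m}x^{-2\beta}e^{-m/x}$, $x\in(0,\infty)$, with median $\bar x_{\beta,m}$. Then for every $1\le p<\infty$ and every smooth $\phi:(0,\infty)\to\mathbb R$ with $E[|\phi(X)|^p]<\infty$, $$E\big[|\phi(X)-E(\phi(X))|^p\big]\le \big(p\,D(\beta,m)\big)^p\,E\big[X^p|\phi'(X)|^p\big],\qquad D(\beta,m)=\frac{1}{\bar x_{\beta,m}\,h_{\beta,m}(\bar x_{\beta,m})}.$$
   Context: $C_{\beta,m}>0$ is the normalizing constant making $h_{\beta,m}$ a probability density on $(0,\infty)$. The median $\bar x_{\beta,m}$ is the point where $\int_0^{\bar x_{\beta,m}}h_{\beta,m}(x)\,dx=1/2$. *)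

(* Defs.v *)
From HB Require Import structures.
From mathcomp Require Import all_boot all_order all_algebra.
From mathcomp Require Import all_classical all_reals all_analysis.
Set Implicit Arguments. Unset Strict Implicit. Unset Printing Implicit Defensive.
Import Order.TTheory GRing.Theory Num.Theory.
Import numFieldNormedType.Exports.
Local Open Scope classical_set_scope.
Local Open Scope ring_scope.

Section Defs.
Variable R : realType.
Local Notation mu := (@lebesgue_measure R).
Definition pos_half_line : set R := `]0, +oo[%classic.
Definition seg0 (b : R) : set R := `]0, b[%classic.

Definition g_bm (beta m : R) (x : R) : R := x `^ (- (2 * beta)) * expR (- (m / x)).

Definition C_bm (beta m : R) : R :=
  (fine (\int[mu]_(x in pos_half_line) (g_bm beta m x)%:E))^-1.

Definition h_bm (beta m : R) (x : R) : R := C_bm beta m * g_bm beta m x.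

Definition Eh (beta m : R) (f : R -> R) : \bar R :=
  (\int[mu]_(x in pos_half_line) (f x * h_bm beta m x)%:E)%E.

Definition is_median (beta m xbar : R) : Prop :=
  (\int[mu]_(x in seg0 xbar) (h_bm beta m x)%:E)%E = (2^-1)%:E.

Definition D_bm (beta m xbar : R) : R := (xbar * h_bm beta m xbar)^-1.

Definition smooth_pos (phi : R -> R) : Prop :=
  forall (n : nat) (x : R), 0 < x -> derivable (derive1n n phi) x 1.
End Defs.

(* Main.v *)
Require Import Defs.
From HB Require Import structures.
From mathcomp Require Import all_boot all_order all_algebra.
From mathcomp Require Import all_classical all_reals all_analysis.
From mathcomp Require Import measurable_realfun ring lra.
Set Implicit Arguments. Unset Strict Implicit. Unset Printing Implicit Defensive.
Import Order.TTheory GRing.Theory Num.Theory.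
Import numFieldNormedType.Exports.
Local Open Scope classical_set_scope.
Local Open Scope ring_scope.

(** Let [F] be the distribution function of [X], [c] the median of [X] and
    [g x = D x], so that [g c * h c = 1 = 2 * F c]. Up to a constant [g * h] is the
    density of [ln X], which is log-concave; hence [g * h - 2 F] and [g * h + 2 F]
    are quasiconcave, so that [2 F <= g * h] on the left of [c] and
    [2 (1 - F) <= g * h] on its right. Integrating the derivative of
    [|phi - phi c|^p F] on the left and of [|phi - phi c|^p (F - 1)] on the right,
    and absorbing the cross term with Young's inequality
    [p a^(p-1) b <= (p - 1) a^p + b^p], gives the Hardy inequality
    [E |phi - phi c|^p <= E |p (g / 2) phi'|^p]. Replacing [phi c] by the mean costs
    a factor [2^p], by convexity of [t^p] and Jensen's inequality. *)

(** * Moments with respect to a density *)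

Lemma young_powR (R : realType) (p x y : R) : 1 <= p -> 0 <= x -> 0 <= y ->
  p * (x `^ (p - 1) * y) <= (p - 1) * x `^ p + y `^ p.
Proof.
rewrite le_eqVlt => /predU1P[<- x0 y0|p1 x0 y0].
  by rewrite subrr powRr0 !mul1r mul0r add0r powRr1.
have p0 : 0 < p by lra.
have pB0 : 0 < p - 1 by lra.
have := @conjugate_powR R (x `^ (p - 1)) y (p / (p - 1)) p
  (powR_ge0 _ _) y0 (divr_gt0 p0 pB0) p0.
have -> : (p / (p - 1))^-1 + p^-1 = 1 by field; rewrite !gt_eqF.
move=> /(_ erefl); rewrite -powRrM.
have -> : (p - 1) * (p / (p - 1)) = p by field; rewrite gt_eqF.
rewrite -(ler_pM2l p0) => /le_trans; apply.
by rewrite le_eqVlt; apply/predU1P; left; field; rewrite !gt_eqF.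
Qed.

Lemma powRD_le (R : realType) (p x y : R) : 1 <= p -> 0 <= x -> 0 <= y ->
  (x + y) `^ p <= 2 `^ (p - 1) * (x `^ p + y `^ p).
Proof.
move=> p1 x0 y0; have p0 : 0 < p by lra.
pose s := (x + y) / 2; have s0 : 0 <= s by rewrite divr_ge0 ?addr_ge0.
have -> : x + y = 2 * s by rewrite /s; field.
rewrite powRM// -(mulr_powRB1 (ltW (ltr0n R 2)) p0) -mulrA mulrCA.
rewrite ler_pM2l ?powR_gt0//.
have Ysx := @young_powR R p s x p1 s0 x0; have Ysy := @young_powR R p s y p1 s0 y0.
have : s `^ (p - 1) * x + s `^ (p - 1) * y = 2 * s `^ p.
  by rewrite -(mulr_powRB1 s0 p0) /s; field.
nra.
Qed.

Lemma ler_norm_powR (R : realType) (p x y : R) : 0 <= p -> `|x| <= `|y| ->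
  `|x| `^ p <= `|y| `^ p.
Proof. by move=> p0 xy; apply: ge0_ler_powR; rewrite ?nnegrE. Qed.

Lemma norm_powRM_ge0 (R : realType) (p a x y : R) : 0 <= a -> 0 <= x ->
  `|a * x * y| `^ p = a `^ p * (x `^ p * `|y| `^ p).
Proof.
move=> a0 x0; rewrite !normrM (ger0_norm a0) (ger0_norm x0).
by rewrite !powRM ?mulr_ge0// mulrA.
Qed.

Section weighted_mean.
Context d (T : measurableType d) (R : realType).
Variables (mu : {measure set T -> \bar R}) (D : set T) (h : T -> R).

Definition weighted_integrable (f : T -> R) : Prop :=
  mu.-integrable D (EFin \o (fun x => f x * h x)).

Definition weighted_mean (f : T -> R) : R :=
  (\int[mu]_(x in D) (f x * h x))%R.

Hypotheses (mD : measurable D) (mh : measurable_fun D h)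
  (h_ge0 : forall x, D x -> 0 <= h x)
  (h_mass1 : (\int[mu]_(x in D) (h x)%:E = 1)%E).

Implicit Types (f g : T -> R) (c p : R).

Lemma ge0_weighted_integrable f : measurable_fun D f ->
  (forall x, D x -> 0 <= f x) ->
  (\int[mu]_(x in D) (f x * h x)%:E < +oo)%E -> weighted_integrable f.
Proof.
move=> mf f0 fh_lty; apply/integrableP; split.
  exact/measurable_EFinP/measurable_funM.
rewrite (eq_integral (EFin \o (fun x => f x * h x)))// => x /set_mem Dx /=.
by rewrite ger0_norm// mulr_ge0 ?f0 ?h_ge0.
Qed.

Lemma weighted_integrable_cst c : weighted_integrable (cst c).
Proof.
have ih : mu.-integrable D (EFin \o h).
  rewrite (_ : h = fun x => cst 1 x * h x); last first.
    by apply/funext => x; rewrite mul1r.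
  apply: ge0_weighted_integrable => //.
  by under eq_integral do rewrite mul1r; rewrite h_mass1 ltry.
exact: (integrableZl mD c ih).
Qed.

Lemma weighted_integrableD f g : weighted_integrable f -> weighted_integrable g ->
  weighted_integrable (fun x => f x + g x).
Proof.
move=> fi gi; apply: eq_integrable (integrableD mD fi gi) => // x _ /=.
by rewrite -EFinD mulrDl.
Qed.

Lemma weighted_integrableZ c f : weighted_integrable f ->
  weighted_integrable (fun x => c * f x).
Proof.
move=> fi; apply: eq_integrable (integrableZl mD c fi) => // x _ /=.
by rewrite -EFinM mulrA.
Qed.

Lemma le_weighted_integrable f g : measurable_fun D f ->
  (forall x, D x -> `|f x| <= g x) -> weighted_integrable g ->
  weighted_integrable f.
Proof.
move=> mf fg; apply: le_integrable => //.
  exact/measurable_EFinP/measurable_funM.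
move=> x Dx; rewrite lee_fin !normrM ler_wpM2r// (le_trans (fg x Dx))//.
exact: ler_norm.
Qed.

Lemma weighted_mean_cst c : weighted_mean (cst c) = c.
Proof.
rewrite /weighted_mean RintegralZl//; last first.
  by apply: eq_integrable (weighted_integrable_cst 1) => // x _ /=; rewrite mul1r.
by rewrite /Rintegral h_mass1 mulr1.
Qed.

Lemma weighted_meanD f g : weighted_integrable f -> weighted_integrable g ->
  weighted_mean (fun x => f x + g x) = weighted_mean f + weighted_mean g.
Proof.
move=> fi gi; rewrite /weighted_mean -RintegralD//.
by apply: eq_Rintegral => x _; rewrite mulrDl.
Qed.

Lemma weighted_meanZ c f : weighted_integrable f ->
  weighted_mean (fun x => c * f x) = c * weighted_mean f.
Proof.
move=> fi; rewrite /weighted_mean -RintegralZl//.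
by apply: eq_Rintegral => x _; rewrite mulrA.
Qed.

Lemma le_weighted_mean f g : weighted_integrable f -> weighted_integrable g ->
  (forall x, D x -> f x <= g x) -> weighted_mean f <= weighted_mean g.
Proof.
by move=> fi gi fg; apply: le_Rintegral => // x Dx; rewrite ler_wpM2r ?h_ge0 ?fg.
Qed.

Lemma EFin_weighted_mean f : weighted_integrable f ->
  (weighted_mean f)%:E = (\int[mu]_(x in D) (f x * h x)%:E)%E.
Proof. by move=> fi; rewrite fineK//; exact: integrable_fin_num. Qed.

Lemma measurable_norm_powR f p : measurable_fun D f ->
  measurable_fun D (fun x => `|f x| `^ p).
Proof.
by move=> mf; apply: (measurableT_comp (measurable_powR p)); exact: measurableT_comp.
Qed.

Section exponent.
Variable p : R.
Hypothesis p_ge1 : 1 <= p.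

Let p_gt0 : 0 < p. Proof. exact: lt_le_trans p_ge1. Qed.

Lemma weighted_integrable_norm f : measurable_fun D f ->
  weighted_integrable (fun x => `|f x| `^ p) ->
  weighted_integrable (fun x => `|f x|).
Proof.
move=> mf fpi; apply: (@le_weighted_integrable _ (fun x => 1 + `|f x| `^ p)).
- exact: measurableT_comp.
- move=> x _; rewrite normr_id.
  have := young_powR p_ge1 ler01 (normr_ge0 (f x)); rewrite !powR1/= mul1r mulr1.
  move: p_ge1 (powR_ge0 `|f x| p); nra.
- exact: weighted_integrableD (weighted_integrable_cst 1) fpi.
Qed.

Lemma jensen_norm_powR f : measurable_fun D f ->
  weighted_integrable (fun x => `|f x| `^ p) ->
  `|weighted_mean f| `^ p <= weighted_mean (fun x => `|f x| `^ p).
Proof.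
move=> mf fpi; set a := `|weighted_mean f|; have a0 : 0 <= a by exact: normr_ge0.
have ni := weighted_integrable_norm mf fpi.
have fi : weighted_integrable f by exact: le_weighted_integrable ni.
have a_le : a <= weighted_mean (fun x => `|f x|).
  have -> : weighted_mean (fun x => `|f x|) = (\int[mu]_(x in D) `|f x * h x|)%R.
    apply: eq_Rintegral => x /set_mem Dx.
    by rewrite normrM (ger0_norm (h_ge0 Dx)).
  exact: le_normr_Rintegral.
have mean_tangent : p * a `^ (p - 1) * weighted_mean (fun x => `|f x|) <=
    (p - 1) * a `^ p + weighted_mean (fun x => `|f x| `^ p).
  have ci := weighted_integrable_cst ((p - 1) * a `^ p).
  rewrite -weighted_meanZ// -[(p - 1) * _]weighted_mean_cst -weighted_meanD//.
  apply: le_weighted_mean.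
  - exact: weighted_integrableZ.
  - exact: weighted_integrableD.
  - by move=> x _; rewrite -mulrA young_powR.
have : p * a `^ (p - 1) * a <= p * a `^ (p - 1) * weighted_mean (fun x => `|f x|).
  by rewrite ler_wpM2l// mulr_ge0 ?powR_ge0// ltW.
rewrite -[_ * _ * a]mulrA [_ `^ _ * a]mulrC mulr_powRB1//; lra.
Qed.

Lemma weighted_integrable_powRB f c : measurable_fun D f ->
  weighted_integrable (fun x => `|f x| `^ p) ->
  weighted_integrable (fun x => `|f x - c| `^ p).
Proof.
move=> mf fpi; apply: (@le_weighted_integrable _
    (fun x => 2 `^ (p - 1) * (`|f x| `^ p + cst (`|c| `^ p) x))).
- by apply: measurable_norm_powR; exact: measurable_funB.
- move=> x _; rewrite ger0_norm ?powR_ge0//.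
  apply: le_trans (powRD_le p_ge1 (normr_ge0 _) (normr_ge0 _)).
  by apply: ge0_ler_powR; rewrite ?nnegrE ?addr_ge0 ?(ltW p_gt0) ?ler_normB.
- apply: weighted_integrableZ; apply: weighted_integrableD => //.
  exact: weighted_integrable_cst.
Qed.

Lemma centered_moment_le f c : measurable_fun D f ->
  weighted_integrable (fun x => `|f x| `^ p) ->
  weighted_mean (fun x => `|f x - weighted_mean f| `^ p) <=
  2 `^ p * weighted_mean (fun x => `|f x - c| `^ p).
Proof.
move=> mf fpi; set e := weighted_mean f.
have mfc : measurable_fun D (fun x => f x - c) by exact: measurable_funB.
have fcpi := weighted_integrable_powRB c mf fpi.
have fi : weighted_integrable f.
  exact: le_weighted_integrable (weighted_integrable_norm mf fpi).
have meanB : weighted_mean (fun x => f x - c) = e - c.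
  rewrite (@weighted_meanD f (cst (- c))) ?weighted_mean_cst//.
  exact: weighted_integrable_cst.
have convexity x : `|f x - e| `^ p <=
    2 `^ (p - 1) * (`|f x - c| `^ p + cst (`|e - c| `^ p) x).
  apply: le_trans (powRD_le p_ge1 (normr_ge0 _) (normr_ge0 _)).
  apply: ge0_ler_powR; rewrite ?nnegrE ?addr_ge0 ?(ltW p_gt0)//.
  by rewrite (_ : f x - e = (f x - c) - (e - c)) ?ler_normB//; ring.
have ci := weighted_integrable_cst (`|e - c| `^ p).
apply: (@le_trans _ _ (2 `^ (p - 1) *
    (weighted_mean (fun x => `|f x - c| `^ p) + `|e - c| `^ p))).
  rewrite -[`|e - c| `^ p]weighted_mean_cst -weighted_meanD// -weighted_meanZ//.
    apply: le_weighted_mean; first exact: weighted_integrable_powRB.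
    + by apply: weighted_integrableZ; exact: weighted_integrableD.
    + by move=> x _; exact: convexity.
  exact: weighted_integrableD.
have := jensen_norm_powR mfc fcpi; rewrite meanB => jensen.
rewrite -(mulr_powRB1 (ltW (ltr0n R 2)) p_gt0) [2 * _]mulrC -mulrA.
by rewrite ler_pM2l ?powR_gt0//; lra.
Qed.

End exponent.
End weighted_mean.

(** * Calculus on the half-line *)

Section calculus.
Context (R : realType).
Implicit Types (f h F : R -> R) (a b x : R).
Local Notation mu := (@lebesgue_measure R).

Lemma is_derive1_continuous f x df : is_derive x 1 f df -> {for x, continuous f}.
Proof.
by move=> fx; apply/differentiable_continuous/derivable1_diffP; exact: ex_derive.
Qed.

Lemma continuous_norm_powR (p : R) : 0 < p -> continuous (fun x : R => `|x| `^ p).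
Proof.
move=> p0 x; have [->|x0] := eqVneq x 0; last first.
  apply: (@continuous_comp _ _ _ (@Num.norm R R) (@powR R ^~ p)).
    exact: norm_continuous.
  by apply: is_derive1_continuous; apply: is_derive1_powR; rewrite normr_gt0.
apply/cvgrPdist_lt => e e0 /=; rewrite normr0 powR0 ?gt_eqF//.
have r0 : 0 < e `^ p^-1 by rewrite powR_gt0.
near=> t; rewrite sub0r normrN ger0_norm ?powR_ge0//.
have -> : e = (e `^ p^-1) `^ p by rewrite -powRrM mulVf ?gt_eqF// powRr1 ?ltW.
by apply: gt0_ltr_powR; rewrite ?nnegrE ?powR_ge0.
Unshelve. all: by end_near. Qed.

Lemma continuous_norm_powRM (p : R) f h x : 0 < p ->
  {for x, continuous f} -> {for x, continuous h} ->
  {for x, continuous (fun y => `|f y| `^ p * h y)}.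
Proof.
move=> p0 f_cont h_cont; apply: continuousM => //.
apply: (@continuous_comp _ _ _ f (fun t : R => `|t| `^ p)) => //.
exact: continuous_norm_powR.
Qed.

Lemma is_derive_segment_continuous F f a b :
  {in `[a, b], forall x, is_derive x 1 F (f x)} -> {within `[a, b], continuous F}.
Proof.
by move=> dF; apply: derivable_within_continuous => x /dF ?; exact: ex_derive.
Qed.

Lemma continuous_segment_integrable f a b :
  {in `[a, b], forall x, {for x, continuous f}} ->
  mu.-integrable `[a, b] (EFin \o f).
Proof.
move=> cf; apply: continuous_compact_integrable; first exact: segment_compact.
exact: continuous_subspace_itv.
Qed.

Lemma Rintegral_is_derive F f a b : a <= b ->
  {in `[a, b], forall x, is_derive x 1 F (f x)} ->
  {in `[a, b], forall x, {for x, continuous f}} ->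
  (\int[mu]_(x in `[a, b]) f x)%R = F b - F a.
Proof.
rewrite le_eqVlt => /predU1P[<- _ _|ab dF cf].
  by rewrite set_itv1 Rintegral_set1 subrr.
have itvoo_cc x : x \in `]a, b[ -> x \in `[a, b].
  by apply: subset_itvW; rewrite lexx.
rewrite /Rintegral (@continuous_FTC2 _ f F)//.
- exact: continuous_subspace_itv.
- split=> [x /itvoo_cc/dF ?||]; first exact: ex_derive.
  + apply/cvg_at_right_filter/(is_derive1_continuous (dF _ _)).
    by rewrite bound_itvE ltW.
  + apply/cvg_at_left_filter/(is_derive1_continuous (dF _ _)).
    by rewrite bound_itvE ltW.
- by move=> x /itvoo_cc/dF ?; rewrite derive1E derive_val.
Qed.

Lemma quasiconcave_segment F f s a b :
  {in `[a, b], forall x, is_derive x 1 F (f x * s x)} ->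
  {in `[a, b], forall x, 0 <= f x} ->
  {in `[a, b] &, {homo s : x y /~ x <= y}} ->
  {in `[a, b], forall x, Num.min (F a) (F b) <= F x}.
Proof.
move=> dF f_ge0 s_dec x xab; have /andP[ax xb] := xab.
have left_sub y : y \in `[a, x] -> y \in `[a, b].
  by apply: subset_itvl; rewrite bnd_simp.
have right_sub y : y \in `[x, b] -> y \in `[a, b].
  by apply: subset_itvr; rewrite bnd_simp.
rewrite ge_min; have [s_ge0|/ltW s_le0] := leP 0 (s x); apply/orP; [left|right].
  have [y /[dup] yax /left_sub yab FE] := @MVT_segment _ F _ a x ax
    (fun y yax => dF y (left_sub _ (subset_itv_oo_cc yax)))
    (is_derive_segment_continuous (fun y yax => dF y (left_sub _ yax))).
  rewrite -subr_ge0 FE mulr_ge0 ?subr_ge0// mulr_ge0 ?f_ge0//.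
  by rewrite (le_trans s_ge0)// s_dec// (itvP yax).
have [y /[dup] yxb /right_sub yab FE] := @MVT_segment _ F _ x b xb
  (fun y yxb => dF y (right_sub _ (subset_itv_oo_cc yxb)))
  (is_derive_segment_continuous (fun y yxb => dF y (right_sub _ yxb))).
rewrite -subr_le0 FE mulr_le0_ge0 ?subr_ge0// mulr_ge0_le0 ?f_ge0//.
by rewrite (le_trans _ s_le0)// s_dec// (itvP yxb).
Qed.

End calculus.

Lemma pos_half_lineE (R : realType) (x : R) : pos_half_line x = (0 < x) :> Prop.
Proof. by rewrite /pos_half_line/= in_itv/= andbT. Qed.

Lemma measurable_pos_half_line (R : realType) : measurable (@pos_half_line R).
Proof. exact: measurable_itv. Qed.
#[local] Hint Extern 0 (measurable _) =>
  solve [exact: measurable_pos_half_line] : core.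

Section half_line.
Context (R : realType).
Implicit Types (f : R -> R) (a b x : R).
Local Notation mu := (@lebesgue_measure R).
Local Notation P := (@pos_half_line R).

Lemma segment_gt0 a b x : 0 < a -> x \in `[a, b] -> 0 < x.
Proof. by move=> a0 xab; rewrite (lt_le_trans a0)// (itvP xab). Qed.

Lemma segment_sub_pos_half_line a b : 0 < a -> `[a, b] `<=` P.
Proof. by move=> a0 x xab; rewrite pos_half_lineE (segment_gt0 a0 xab). Qed.

Lemma continuous_pos_measurable f : (forall x, 0 < x -> {for x, continuous f}) ->
  measurable_fun P f.
Proof.
move=> cf; apply: open_continuous_measurable_fun; first exact: interval_open.
by move=> x /set_mem; rewrite pos_half_lineE; exact: cf.
Qed.

Lemma ge0_integral_pos_half_lineZl (c : R) f : 0 <= c ->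
  measurable_fun P f -> (forall x, 0 < x -> 0 <= f x) ->
  (\int[mu]_(x in P) (c * f x)%:E = c%:E * \int[mu]_(x in P) (f x)%:E)%E.
Proof.
move=> c0 mf f0; under eq_integral do rewrite EFinM.
rewrite ge0_integralZl_EFin//; last exact/measurable_EFinP.
by move=> x; rewrite pos_half_lineE lee_fin; exact: f0.
Qed.

Lemma bigcup_segments_pos_half_line x0 : 0 < x0 ->
  \bigcup_n `[x0 / n.+1%:R, x0 * n.+1%:R]%classic = P.
Proof.
move=> x0_gt0; apply/seteqP; split=> [x [n _]|x].
  by apply: segment_sub_pos_half_line; rewrite divr_gt0.
rewrite pos_half_lineE => x_gt0.
exists (Num.truncn (x0 / x) + Num.truncn (x / x0))%N => //=.
set n := (_ + _)%N.
have x0x_le : x0 / x <= n.+1%:R.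
  by rewrite (le_trans (ltW (truncnS_gt _)))// ler_nat ltnS leq_addr.
have xx0_le : x / x0 <= n.+1%:R.
  by rewrite (le_trans (ltW (truncnS_gt _)))// ler_nat ltnS leq_addl.
rewrite in_itv/=; apply/andP; split.
  by rewrite ler_pdivrMr// mulrC -ler_pdivrMr.
by rewrite mulrC -ler_pdivrMr.
Qed.

Lemma ge0_integral_pos_half_line_le f x0 (M : \bar R) : 0 < x0 ->
  measurable_fun P f -> (forall x, 0 < x -> 0 <= f x) ->
  (forall a b, 0 < a -> a <= x0 -> x0 <= b ->
    (\int[mu]_(x in `[a, b]) (f x)%:E <= M)%E) ->
  (\int[mu]_(x in P) (f x)%:E <= M)%E.
Proof.
move=> x0_gt0 mf f0 fM.
pose A (n : nat) : set R := `[x0 / n.+1%:R, x0 * n.+1%:R]%classic.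
have AP n : A n `<=` P by apply: segment_sub_pos_half_line; rewrite divr_gt0.
have cvA : (\int[mu]_(x in A n) (f x)%:E @[n --> \oo] -->
    \int[mu]_(x in \bigcup_n A n) (f x)%:E)%E.
  apply: ge0_nondecreasing_set_cvg_integral => [m n mn|n|n|n x /AP].
  - apply/subsetPset/subset_itv; rewrite bnd_simp.
      by rewrite ler_pM2l// lef_pV2 ?posrE// ler_nat.
    by rewrite ler_pM2l// ler_nat.
  - exact: measurable_itv.
  - apply/measurable_EFinP; apply: measurable_funS (AP n) mf.
    exact: measurable_pos_half_line.
  - by rewrite pos_half_lineE lee_fin => /f0.
rewrite -(bigcup_segments_pos_half_line x0_gt0) -(cvg_lim _ cvA)//.
apply: lime_le; first exact: cvgP cvA.
apply: nearW => n; apply: fM; first by rewrite divr_gt0.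
- by rewrite ler_pdivrMr// ler_peMr ?ler1n// ltW.
- by rewrite ler_peMr ?ler1n// ltW.
Qed.

End half_line.

(** * Tails of a density on the half-line *)

Section density_cdf.
Context (R : realType).
Local Notation mu := (@lebesgue_measure R).
Local Notation P := (@pos_half_line R).
Variable h : R -> R.

Definition density_cdf (t : R) : R := (\int[mu]_(x in `]0, t]) h x)%R.

Hypotheses (h_ge0 : forall x : R, 0 < x -> 0 <= h x)
  (h_cont : forall x : R, 0 < x -> {for x, continuous h})
  (h_mass1 : (\int[mu]_(x in P) (h x)%:E = 1)%E).

Let oc_sub (t : R) : `]0, t] `<=` P.
Proof. by apply: subset_itvl; rewrite bnd_simp. Qed.

Let integrable_density : mu.-integrable P (EFin \o h).
Proof.
have mh := continuous_pos_measurable h_cont.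
apply/integrableP; split; first exact/measurable_EFinP.
by rewrite integral_fin_num_abs ?h_mass1.
Qed.

Let integrable_density_oc (t : R) : mu.-integrable `]0, t] (EFin \o h).
Proof. by apply: integrableS integrable_density; last exact: oc_sub. Qed.

Lemma EFin_density_cdf t :
  (density_cdf t)%:E = (\int[mu]_(x in `]0%R, t]) (h x)%:E)%E.
Proof. by rewrite fineK//; exact: integrable_fin_num. Qed.

Lemma density_cdf_ge0 t : 0 <= density_cdf t.
Proof.
by apply: Rintegral_ge0 => x /oc_sub; rewrite pos_half_lineE; exact: h_ge0.
Qed.

Lemma density_cdf_le1 t : density_cdf t <= 1.
Proof.
rewrite -lee_fin EFin_density_cdf -h_mass1; apply: ge0_subset_integral => //.
- by apply/measurable_EFinP; exact: continuous_pos_measurable.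
- by move=> x; rewrite pos_half_lineE lee_fin; exact: h_ge0.
Qed.

Lemma is_derive_density_cdf (t : R) : 0 < t -> is_derive t 1 density_cdf (h t).
Proof.
move=> t0; have tu : t < t + 1 by rewrite ltrDl.
have [//|dF FE] := continuous_FTC1 tu (integrable_density_oc (t + 1)) _ (h_cont t0).
by split => //; rewrite -derive1E.
Qed.

Lemma density_cdf_increment_bound_ge1 (x0 l : R) : 0 < x0 ->
  (forall a b, 0 < a -> a <= x0 -> x0 <= b ->
    density_cdf b - density_cdf a <= l) -> 1 <= l.
Proof.
move=> x0_gt0 incr_le; rewrite -lee_fin -h_mass1.
apply: (ge0_integral_pos_half_line_le x0_gt0) => //.
  exact: continuous_pos_measurable.
move=> a b a0 ax0 x0b; have pos x := @segment_gt0 R a b x a0.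
have ih : mu.-integrable `[a, b] (EFin \o h).
  by apply: continuous_segment_integrable => x /pos; exact: h_cont.
rewrite -[leLHS]fineK; last exact: integrable_fin_num.
rewrite lee_fin -/(Rintegral _ _ _) (@Rintegral_is_derive _ density_cdf).
- exact: incr_le.
- exact: le_trans x0b.
- by move=> x /pos; exact: is_derive_density_cdf.
- by move=> x /pos; exact: h_cont.
Qed.

(* For [g x = x], [g * h] is the density of [ln X], [s] is its logarithmic derivative
   in the variable [ln x], and [s_dec] says that this density is log-concave. *)
Section tails.
Variables (g s : R -> R) (xm : R).
Hypotheses (xm_gt0 : 0 < xm)
  (g_ge0 : forall x : R, 0 < x -> 0 <= g x)
  (dgh : forall x : R, 0 < x -> is_derive x 1 (fun y => g y * h y) (h x * s x))
  (s_dec : forall x y : R, 0 < x -> x <= y -> s y <= s x)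
  (xm_median : density_cdf xm = 2^-1) (ghxm : g xm * h xm = 1).

Let tail_quasiconcave (k a b x : R) : 0 < a -> x \in `[a, b] ->
  Num.min (g a * h a + k * density_cdf a) (g b * h b + k * density_cdf b) <=
  g x * h x + k * density_cdf x.
Proof.
move=> a0; apply: (@quasiconcave_segment _ (fun y => g y * h y + k * density_cdf y)
  h (fun y => s y + k)) => y.
- move=> /(segment_gt0 a0) y0.
  have dkF := is_deriveM (is_derive_cst k y 1) (is_derive_density_cdf y0).
  apply: (is_derive_eq (is_deriveD (dgh y0) dkF)).
  by rewrite /GRing.scale/=; ring.
- by move=> /(segment_gt0 a0); exact: h_ge0.
- by move=> z _ /(segment_gt0 a0) z0 zy; rewrite lerD2r s_dec.
Qed.

Lemma density_cdf_left_tail x : 0 < x -> x <= xm ->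
  2 * density_cdf x <= g x * h x.
Proof.
move=> x0 xxm; suff : 1 <= 1 + (g x * h x - 2 * density_cdf x) / 2 by lra.
apply: (density_cdf_increment_bound_ge1 x0) => a b a0 ax _.
have gha_ge0 := mulr_ge0 (g_ge0 a0) (h_ge0 a0).
have Fa_ge0 := density_cdf_ge0 a; have Fb_le1 := density_cdf_le1 b.
have /(tail_quasiconcave (-2) a0) : x \in `[a, xm] by rewrite in_itv/= ax.
by rewrite ghxm xm_median ge_min => /orP[|]; lra.
Qed.

Lemma density_cdf_right_tail x : xm <= x ->
  2 * (1 - density_cdf x) <= g x * h x.
Proof.
move=> xmx; have x0 : 0 < x := lt_le_trans xm_gt0 xmx.
suff : 1 <= density_cdf x + g x * h x / 2 by lra.
apply: (density_cdf_increment_bound_ge1 x0) => a b a0 _ xb.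
have b0 := lt_le_trans x0 xb.
have ghb_ge0 := mulr_ge0 (g_ge0 b0) (h_ge0 b0).
have Fa_ge0 := density_cdf_ge0 a; have Fb_le1 := density_cdf_le1 b.
have /(tail_quasiconcave 2 xm_gt0) : x \in `[xm, b] by rewrite in_itv/= xmx.
by rewrite ghxm xm_median ge_min => /orP[|]; lra.
Qed.

End tails.
End density_cdf.

(** * Hardy's inequality around the median *)

(* [smooth_abs] replaces [|t|], whose [p]-th power is not differentiable at [0]
   when [p = 1]. *)
Section smooth_abs.
Context (R : realType).
Variable e : R.
Hypothesis e_gt0 : 0 < e.
Implicit Type t : R.

Definition smooth_abs t : R := Num.sqrt (t ^+ 2 + e ^+ 2).

Let sqrD_gt0 t : 0 < t ^+ 2 + e ^+ 2.
Proof. by rewrite ltr_wpDl ?sqr_ge0// exprn_gt0. Qed.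

Lemma smooth_abs_gt0 t : 0 < smooth_abs t.
Proof. by rewrite sqrtr_gt0. Qed.

Lemma smooth_abs0 : smooth_abs 0 = e.
Proof. by rewrite /smooth_abs expr0n add0r sqrtr_sqr gtr0_norm. Qed.

Lemma ler_norm_smooth_abs t : `|t| <= smooth_abs t.
Proof. by rewrite -sqrtr_sqr ler_wsqrtr// lerDl sqr_ge0. Qed.

Lemma is_derive_smooth_abs t : is_derive t 1 smooth_abs (t / smooth_abs t).
Proof.
have dsqr : is_derive t 1 (fun x => x ^+ 2 + e ^+ 2) (2 * t).
  by apply: is_derive_eq; rewrite /GRing.scale/=; ring.
have dsqrt := is_derive1_sqrt (sqrD_gt0 t).
have dcomp := @is_derive1_comp _ _ (fun x => x ^+ 2 + e ^+ 2) _ _ _ dsqrt dsqr.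
apply: (is_derive_eq dcomp).
rewrite -/(smooth_abs t).
by field; rewrite gt_eqF// smooth_abs_gt0.
Qed.

Lemma norm_derive_smooth_abs_le1 t : `|t / smooth_abs t| <= 1.
Proof.
rewrite normrM normfV (gtr0_norm (smooth_abs_gt0 t)).
by rewrite ler_pdivrMr ?smooth_abs_gt0// mul1r ler_norm_smooth_abs.
Qed.

Lemma continuous_derive_smooth_abs t :
  {for t, continuous (fun t => t / smooth_abs t)}.
Proof.
apply: continuousM; first exact: cvg_id.
apply: continuousV; first by rewrite gt_eqF// smooth_abs_gt0.
exact: is_derive1_continuous (is_derive_smooth_abs t).
Qed.

End smooth_abs.

(* [u^p h + T (u^p)'] is the derivative of [u^p T] when [T' = h]; Young's
   inequality absorbs its second term. *)
Lemma hardy_pointwise (R : realType) (p u du T g h : R) :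
  1 <= p -> 0 <= u -> 0 <= h -> `|T| <= g * h ->
  u `^ p * h <= `|p * g * du| `^ p * h +
    p * (u `^ p * h + T * (p * u `^ (p - 1) * du)).
Proof.
move=> p1 u0 h0 Tgh; have p0 : 0 <= p by lra.
have v0 := powR_ge0 u (p - 1); set v := u `^ (p - 1) in v0 *.
have cross_le : - (T * (p * v * du)) <= v * `|p * g * du| * h.
  rewrite (le_trans (ler_norm _))// normrN !normrM (ger0_norm p0) (ger0_norm v0).
  have gh_le : g * h <= `|g| * h by rewrite ler_wpM2r ?ler_norm.
  rewrite (_ : _ * h = `|g| * h * (p * v * `|du|)); last by ring.
  by rewrite ler_wpM2r ?(le_trans Tgh)// !mulr_ge0.
have := ler_wpM2r h0 (young_powR p1 u0 (normr_ge0 (p * g * du))).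
rewrite -/v; have := ler_wpM2l p0 cross_le; lra.
Qed.

Section hardy_segment.
Context (R : realType).
Local Notation mu := (@lebesgue_measure R).
Implicit Type x : R.
Variables (p c a b : R) (phi dphi g h T : R -> R).
Hypotheses (p_ge1 : 1 <= p) (ab : a <= b).
Hypotheses
  (dphiE : {in `[a, b], forall x, is_derive x 1 phi (dphi x)})
  (dphi_cont : {in `[a, b], forall x, {for x, continuous dphi}})
  (g_cont : {in `[a, b], forall x, {for x, continuous g}})
  (h_ge0 : {in `[a, b], forall x, 0 <= h x})
  (h_cont : {in `[a, b], forall x, {for x, continuous h}})
  (dT : {in `[a, b], forall x, is_derive x 1 T (h x)})
  (T_le : {in `[a, b], forall x, `|T x| <= g x * h x}).

Let p_gt0 : 0 < p. Proof. exact: lt_le_trans p_ge1. Qed.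

Let phi_cont : {in `[a, b], forall x, {for x, continuous phi}}.
Proof. by move=> x /dphiE; exact: is_derive1_continuous. Qed.

Let integrable_norm_powR (f : R -> R) :
  {in `[a, b], forall x, {for x, continuous f}} ->
  mu.-integrable `[a, b] (EFin \o (fun x => `|f x| `^ p * h x)).
Proof.
move=> f_cont; apply: continuous_segment_integrable => x xab.
by apply: continuous_norm_powRM; [|exact: f_cont|exact: h_cont].
Qed.

Section smoothing.
Variable e : R.
Hypothesis e_gt0 : 0 < e.

Let u x := smooth_abs e (phi x - c).
Let du x := (phi x - c) / u x * dphi x.
Let G x := u x `^ p * T x.
Let dG x := u x `^ p * h x + T x * (p * u x `^ (p - 1) * du x).

Let u_gt0 x : 0 < u x. Proof. exact: smooth_abs_gt0. Qed.

Let is_derive_u : {in `[a, b], forall x, is_derive x 1 u (du x)}.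
Proof.
move=> x /dphiE dx; have dB := is_deriveB dx (is_derive_cst c x 1).
apply: is_derive_eq (is_derive1_comp (is_derive_smooth_abs e_gt0 _) dB) _.
by rewrite subr0.
Qed.

Let is_derive_u_powR q : {in `[a, b], forall x,
  is_derive x 1 (fun y => u y `^ q) (q * u x `^ (q - 1) * du x)}.
Proof.
by move=> x /is_derive_u; exact: is_derive1_comp (is_derive1_powR q (u_gt0 x)).
Qed.

Let is_derive_G : {in `[a, b], forall x, is_derive x 1 G (dG x)}.
Proof.
move=> x xab.
exact: is_derive_eq (is_deriveM (is_derive_u_powR p xab) (dT xab)) _.
Qed.

Let dG_cont : {in `[a, b], forall x, {for x, continuous dG}}.
Proof.
move=> x xab.
have u_powR_cont q : {for x, continuous (fun y => u y `^ q)}.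
  exact: is_derive1_continuous (is_derive_u_powR q xab).
apply: continuousD; first by apply: continuousM => //; exact: h_cont.
apply: continuousM; first exact: is_derive1_continuous (dT xab).
apply: continuousM; first by apply: continuousM => //; exact: cvg_cst.
apply: continuousM; last exact: dphi_cont.
apply: (@continuous_comp _ _ _ (fun y => phi y - c) (fun t => t / smooth_abs e t)).
  by apply: continuousB; [exact: phi_cont|exact: cvg_cst].
exact: continuous_derive_smooth_abs.
Qed.

Let norm_powR_le x : x \in `[a, b] ->
  `|phi x - c| `^ p * h x <= `|p * g x * dphi x| `^ p * h x + p * dG x.
Proof.
move=> xab; have hx := h_ge0 xab.
have phi_le_u : `|phi x - c| `^ p <= u x `^ p.
  apply: ge0_ler_powR; rewrite ?nnegrE ?(ltW p_gt0) ?(ltW (u_gt0 x))//.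
  exact: ler_norm_smooth_abs.
have du_le_dphi : `|p * g x * du x| `^ p <= `|p * g x * dphi x| `^ p.
  apply: ler_norm_powR; first exact: ltW.
  rewrite normrM [leRHS]normrM ler_wpM2l// normrM ler_piMl//.
  exact: norm_derive_smooth_abs_le1.
have := hardy_pointwise (du x) p_ge1 (ltW (u_gt0 x)) hx (T_le xab).
have := ler_wpM2r hx phi_le_u; have := ler_wpM2r hx du_le_dphi.
rewrite -/(dG x); lra.
Qed.

Lemma hardy_segment :
  (\int[mu]_(x in `[a, b]) (`|phi x - c| `^ p * h x) <=
   \int[mu]_(x in `[a, b]) (`|p * g x * dphi x| `^ p * h x) +
   p * (smooth_abs e (phi b - c) `^ p * T b -
        smooth_abs e (phi a - c) `^ p * T a))%R.
Proof.
have iphi : mu.-integrable `[a, b] (EFin \o (fun x => `|phi x - c| `^ p * h x)).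
  apply: integrable_norm_powR => x xab.
  by apply: continuousB; [exact: phi_cont|exact: cvg_cst].
have idphi : mu.-integrable `[a, b]
    (EFin \o (fun x => `|p * g x * dphi x| `^ p * h x)).
  apply: integrable_norm_powR => x xab.
  apply: continuousM; last exact: dphi_cont.
  by apply: continuousM; [exact: cvg_cst|exact: g_cont].
have idG := continuous_segment_integrable dG_cont.
have ipdG : mu.-integrable `[a, b] (EFin \o (fun x => p * dG x)).
  by apply: eq_integrable (integrableZl _ p idG).
rewrite -[_ - _]/(G b - G a) -(Rintegral_is_derive ab is_derive_G dG_cont).
rewrite -RintegralZl// -RintegralD//; have idphiD : mu.-integrable `[a, b]
    (EFin \o (fun x => `|p * g x * dphi x| `^ p * h x + p * dG x)).
  by apply: eq_integrable (integrableD _ idphi ipdG).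
exact: (le_Rintegral _ iphi idphiD norm_powR_le).
Qed.

End smoothing.
End hardy_segment.

Lemma Rintegral_segment_split (R : realType) (f : R -> R) (a c b : R) :
  a <= c -> c <= b -> (@lebesgue_measure R).-integrable `[a, b] (EFin \o f) ->
  (\int[@lebesgue_measure R]_(x in `[a, b]) f x =
   \int[@lebesgue_measure R]_(x in `[a, c]) f x +
   \int[@lebesgue_measure R]_(x in `[c, b]) f x)%R.
Proof.
move=> ac cb fi; rewrite -[LHS](subrK (\int[lebesgue_measure]_(x in `[a, c]) f x)%R).
rewrite addrC Rintegral_itvB ?bnd_simp// Rintegral_itv_obnd_cbnd//.
by apply: integrableS fi => //; apply: subset_itvr; rewrite bnd_simp.
Qed.

Section hardy_median.
Context (R : realType).
Local Notation mu := (@lebesgue_measure R).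
Local Notation P := (@pos_half_line R).
Implicit Type x : R.
Variables (p xm : R) (phi dphi g h F : R -> R).
Hypotheses (p_ge1 : 1 <= p) (xm_gt0 : 0 < xm).
Hypotheses (dphiE : forall x, 0 < x -> is_derive x 1 phi (dphi x))
  (dphi_cont : forall x, 0 < x -> {for x, continuous dphi})
  (g_cont : forall x, 0 < x -> {for x, continuous g})
  (h_ge0 : forall x, 0 < x -> 0 <= h x)
  (h_cont : forall x, 0 < x -> {for x, continuous h})
  (dF : forall x, 0 < x -> is_derive x 1 F (h x))
  (F_ge0 : forall x, 0 <= F x) (F_le1 : forall x, F x <= 1)
  (F_left : forall x, 0 < x -> x <= xm -> F x <= g x * h x)
  (F_right : forall x, xm <= x -> 1 - F x <= g x * h x).

Let p_gt0 : 0 < p. Proof. exact: lt_le_trans p_ge1. Qed.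

Let phi_cont x : 0 < x -> {for x, continuous phi}.
Proof. by move=> /dphiE; exact: is_derive1_continuous. Qed.

Let deviation x := `|phi x - phi xm| `^ p * h x.
Let slope x := `|p * g x * dphi x| `^ p * h x.

Let deviation_cont x : 0 < x -> {for x, continuous deviation}.
Proof.
move=> x0; apply: continuous_norm_powRM => //; last exact: h_cont.
by apply: continuousB; [exact: phi_cont|exact: cvg_cst].
Qed.

Let slope_cont x : 0 < x -> {for x, continuous slope}.
Proof.
move=> x0; apply: continuous_norm_powRM => //; last exact: h_cont.
apply: continuousM; last exact: dphi_cont.
by apply: continuousM; [exact: cvg_cst|exact: g_cont].
Qed.

Let integrable_deviation a b : 0 < a -> mu.-integrable `[a, b] (EFin \o deviation).
Proof.
move=> a0; apply: continuous_segment_integrable => x /(segment_gt0 a0).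
exact: deviation_cont.
Qed.

Let integrable_slope a b : 0 < a -> mu.-integrable `[a, b] (EFin \o slope).
Proof.
move=> a0; apply: continuous_segment_integrable => x /(segment_gt0 a0).
exact: slope_cont.
Qed.

Let hardy_one_side (e k a b : R) : 0 < e -> 0 < a -> a <= b ->
  {in `[a, b], forall x, `|F x - k| <= g x * h x} ->
  (\int[mu]_(x in `[a, b]) deviation x <= \int[mu]_(x in `[a, b]) slope x +
   p * (smooth_abs e (phi b - phi xm) `^ p * (F b - k) -
        smooth_abs e (phi a - phi xm) `^ p * (F a - k)))%R.
Proof.
move=> e0 a0 ab Fk_le; have pos := segment_gt0 a0.
apply: (@hardy_segment _ _ _ _ _ _ _ _ _ (fun x => F x - k)) => // x /pos x0.
- exact: dphiE.
- exact: dphi_cont.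
- exact: g_cont.
- exact: h_ge0.
- exact: h_cont.
- by have := dF x0 => ?; apply: is_derive_eq; rewrite subr0.
Qed.

Let hardy_smoothed (e a b : R) : 0 < e -> 0 < a -> a <= xm -> xm <= b ->
  (\int[mu]_(x in `[a, b]) deviation x <=
   \int[mu]_(x in `[a, b]) slope x + p * e `^ p)%R.
Proof.
move=> e0 a0 axm xmb.
have left_half := @hardy_one_side e 0 a xm e0 a0 axm _.
have right_half := @hardy_one_side e 1 xm b e0 xm_gt0 xmb _.
rewrite subrr smooth_abs0// in left_half right_half.
rewrite (Rintegral_segment_split axm xmb) ?integrable_deviation//.
rewrite (Rintegral_segment_split axm xmb) ?integrable_slope//.
apply: le_trans (lerD (left_half _) (right_half _)) _.
- move=> x xaxm; rewrite subr0 ger0_norm// F_left ?(itvP xaxm)//.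
  exact: segment_gt0 xaxm.
- by move=> x xxmb; rewrite distrC ger0_norm ?subr_ge0// F_right ?(itvP xxmb).
rewrite addrACA lerD2l -mulrDr ler_pM2l//.
have := mulr_ge0 (powR_ge0 (smooth_abs e (phi a - phi xm)) p) (F_ge0 a).
have := powR_ge0 (smooth_abs e (phi b - phi xm)) p.
have := F_le1 b; nra.
Qed.

Let hardy_segment_median (a b : R) : 0 < a -> a <= xm -> xm <= b ->
  (\int[mu]_(x in `[a, b]) deviation x <= \int[mu]_(x in `[a, b]) slope x)%R.
Proof.
move=> a0 axm xmb; apply/ler_addgt0Pr => e e0.
have ep0 : 0 < e / p by rewrite divr_gt0.
have -> : e = p * ((e / p) `^ p^-1) `^ p.
  by rewrite -powRrM mulVf ?gt_eqF// powRr1 ?(ltW ep0)// mulrC divfK// gt_eqF.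
by apply: hardy_smoothed => //; rewrite powR_gt0.
Qed.

Lemma hardy_median :
  (\int[mu]_(x in P) (`|phi x - phi xm| `^ p * h x)%:E <=
   \int[mu]_(x in P) (`|p * g x * dphi x| `^ p * h x)%:E)%E.
Proof.
have norm_powR_ge0 (r x : R) : 0 < x -> 0 <= `|r| `^ p * h x.
  by move=> x0; rewrite mulr_ge0 ?powR_ge0 ?h_ge0.
apply: (ge0_integral_pos_half_line_le xm_gt0) => [|x x0|a b a0 axm xmb].
- by apply: continuous_pos_measurable; exact: deviation_cont.
- exact: norm_powR_ge0.
- rewrite -[leLHS]fineK; last exact: integrable_fin_num (integrable_deviation b a0).
  apply: (@le_trans _ _ (\int[mu]_(x in `[a, b]) (slope x)%:E)%E).
    rewrite -[leRHS]fineK; last exact: integrable_fin_num (integrable_slope b a0).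
    by rewrite lee_fin; exact: hardy_segment_median.
  apply: ge0_subset_integral => //; last exact: segment_sub_pos_half_line.
    by apply/measurable_EFinP; apply: continuous_pos_measurable; exact: slope_cont.
  by move=> x; rewrite pos_half_lineE lee_fin; exact: norm_powR_ge0.
Qed.

End hardy_median.

(** * Comparison of centered moments *)

Section poincare.
Context (R : realType).
Local Notation mu := (@lebesgue_measure R).
Local Notation P := (@pos_half_line R).
Implicit Type x : R.
Variables (p xm : R) (phi dphi h g s : R -> R).
Hypotheses (p_ge1 : 1 <= p) (xm_gt0 : 0 < xm).
Hypotheses (dphiE : forall x, 0 < x -> is_derive x 1 phi (dphi x))
  (dphi_cont : forall x, 0 < x -> {for x, continuous dphi})
  (h_ge0 : forall x, 0 < x -> 0 <= h x)
  (h_cont : forall x, 0 < x -> {for x, continuous h})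
  (h_mass1 : (\int[mu]_(x in P) (h x)%:E = 1)%E)
  (g_ge0 : forall x, 0 < x -> 0 <= g x)
  (g_cont : forall x, 0 < x -> {for x, continuous g})
  (dgh : forall x, 0 < x -> is_derive x 1 (fun y => g y * h y) (h x * s x))
  (s_dec : forall x y : R, 0 < x -> x <= y -> s y <= s x)
  (xm_median : density_cdf h xm = 2^-1) (ghxm : g xm * h xm = 1)
  (phi_Lp : (\int[mu]_(x in P) (`|phi x| `^ p * h x)%:E < +oo)%E).

Let hardy_half_weight :
  ((2 `^ p)%:E * \int[mu]_(x in P) (`|phi x - phi xm| `^ p * h x)%:E <=
   \int[mu]_(x in P) (`|p * g x * dphi x| `^ p * h x)%:E)%E.
Proof.
have half_weight x : `|p * g x * dphi x| `^ p * h x =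
    2 `^ p * (`|p * (g x / 2) * dphi x| `^ p * h x).
  rewrite mulrA -powRM// -{1}(ger0_norm (ler0n R 2)) -normrM.
  by congr (`|_| `^ _ * _); field.
under [leRHS]eq_integral do rewrite half_weight.
have g2_cont x : 0 < x -> {for x, continuous (fun y => g y / 2)}.
  by move=> x0; apply: continuousM; [exact: g_cont|exact: cvg_cst].
rewrite ge0_integral_pos_half_lineZl ?powR_ge0//; last 2 first.
- apply: measurable_funM; last exact: continuous_pos_measurable.
  apply: measurable_norm_powR; apply: measurable_funM; last first.
    exact: continuous_pos_measurable.
  by apply: measurable_funM => //; exact: continuous_pos_measurable.
- by move=> x x0; rewrite mulr_ge0 ?powR_ge0 ?h_ge0.
rewrite lee_wpmul2l ?lee_fin ?powR_ge0//.
apply: (hardy_median (F := density_cdf h)) => // x.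
- exact: is_derive_density_cdf.
- exact: density_cdf_ge0.
- exact: density_cdf_le1.
- move=> x0 xxm; suff : 2 * density_cdf h x <= g x * h x by lra.
  exact: (density_cdf_left_tail h_ge0 h_cont h_mass1 g_ge0 dgh s_dec xm_median).
- move=> xmx; suff : 2 * (1 - density_cdf h x) <= g x * h x by lra.
  exact: (density_cdf_right_tail h_ge0 h_cont h_mass1 xm_gt0 g_ge0 dgh s_dec xm_median).
Qed.

Lemma poincare_powR :
  (\int[mu]_(x in P) (`|phi x - weighted_mean mu P h phi| `^ p * h x)%:E <=
   \int[mu]_(x in P) (`|p * g x * dphi x| `^ p * h x)%:E)%E.
Proof.
have hP_ge0 x : P x -> 0 <= h x by rewrite pos_half_lineE; exact: h_ge0.
have mh : measurable_fun P h by exact: continuous_pos_measurable.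
have mphi : measurable_fun P phi.
  by apply: continuous_pos_measurable => x /dphiE; exact: is_derive1_continuous.
have phi_int : weighted_integrable mu P h (fun x => `|phi x| `^ p).
  by apply: ge0_weighted_integrable => //; exact: measurable_norm_powR.
have phiB_int c : weighted_integrable mu P h (fun x => `|phi x - c| `^ p).
  exact: weighted_integrable_powRB.
apply: le_trans hardy_half_weight.
rewrite -!(EFin_weighted_mean _ (phiB_int _))//.
by rewrite -EFinM lee_fin centered_moment_le.
Qed.

End poincare.

Section h_bm.
Context (R : realType).
Local Notation mu := (@lebesgue_measure R).
Local Notation P := (@pos_half_line R).
Variables (beta m : R).
Implicit Types x xm : R.

Lemma g_bm_gt0 x : 0 < x -> 0 < g_bm beta m x.
Proof. by move=> x0; rewrite mulr_gt0 ?powR_gt0 ?expR_gt0. Qed.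

Lemma is_derive_g_bm x : 0 < x ->
  is_derive x 1 (g_bm beta m) (g_bm beta m x * (m / x ^+ 2 - 2 * beta / x)).
Proof.
move=> x0; have xn0 : x != 0 by rewrite gt_eqF.
have dpow := is_derive1_powR (- (2 * beta)) x0.
have dinv := is_deriveV (f := id) xn0 (is_derive_id x 1).
have dmx := is_deriveN (is_deriveM (is_derive_cst m x 1) dinv).
have dexp := is_derive1_comp (is_derive_expR _) dmx.
apply: (is_derive_eq (is_deriveM dpow dexp)).
rewrite powRB ?powRr1 ?(ltW x0)//; last by rewrite xn0 implybT.
by rewrite /GRing.scale/= /g_bm; field.
Qed.

Lemma measurable_g_bm : measurable_fun P (g_bm beta m).
Proof.
apply: continuous_pos_measurable => x x0.
exact: is_derive1_continuous (is_derive_g_bm x0).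
Qed.

(* If the mass of [g_bm] were infinite or zero, the junk values [fine +oo = 0] and
   [0^-1 = 0] would make the density vanish, and there would be no median. *)
Lemma median_C_bm_gt0 xm : is_median beta m xm -> 0 < C_bm beta m.
Proof.
move=> med; rewrite lt_neqAle eq_sym invr_ge0 fine_ge0 ?andbT; last first.
  apply: integral_ge0 => x; rewrite pos_half_lineE lee_fin.
  by move=> /g_bm_gt0/ltW.
apply/eqP => C0; move: med; rewrite /is_median integral0_eq.
  by move=> [] /eqP; rewrite eq_sym invr_eq0 pnatr_eq0.
by move=> x _; rewrite /h_bm C0 mul0r.
Qed.

Lemma median_gt0 xm : is_median beta m xm -> 0 < xm.
Proof.
move=> med; rewrite ltNge; apply/negP => xm0; move: med.
rewrite /is_median /seg0 set_itv_ge; last by rewrite bnd_simp -leNgt.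
rewrite integral_set0 => -[] /eqP.
by rewrite eq_sym invr_eq0 pnatr_eq0.
Qed.

Lemma median_integral_h_bm xm : is_median beta m xm ->
  (\int[mu]_(x in P) (h_bm beta m x)%:E = 1)%E.
Proof.
move=> /median_C_bm_gt0 C0; rewrite ge0_integral_pos_half_lineZl ?(ltW C0)//.
- have := C0; rewrite /C_bm; case: (\int[mu]_(x in P) _)%E => [r| |] /=.
  + by rewrite invr_gt0 => r0; rewrite -EFinM mulVf// gt_eqF.
  + by rewrite invr0 ltxx.
  + by rewrite invr0 ltxx.
- exact: measurable_g_bm.
- by move=> x /g_bm_gt0/ltW.
Qed.

Lemma is_derive_h_bm x : 0 < x ->
  is_derive x 1 (h_bm beta m) (h_bm beta m x * (m / x ^+ 2 - 2 * beta / x)).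
Proof.
move=> /is_derive_g_bm dg.
apply: (is_derive_eq (is_deriveM (is_derive_cst (C_bm beta m) x 1) dg)).
by rewrite /GRing.scale/= /h_bm; ring.
Qed.

Lemma is_derive_linear_mul_h_bm (D x : R) : 0 < x ->
  is_derive x 1 (fun y => D * y * h_bm beta m y)
    (h_bm beta m x * (D * (1 - 2 * beta + m / x))).
Proof.
move=> x0; have dDx : is_derive x 1 (fun y => D * y) D.
  by apply: is_derive_eq; rewrite /GRing.scale/=; ring.
apply: (is_derive_eq (is_deriveM dDx (is_derive_h_bm x0))).
by rewrite /GRing.scale/=; field; rewrite gt_eqF.
Qed.

Lemma continuous_h_bm x : 0 < x -> {for x, continuous (h_bm beta m)}.
Proof. by move=> /is_derive_h_bm; exact: is_derive1_continuous. Qed.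

Lemma median_h_bm_gt0 xm x : is_median beta m xm -> 0 < x -> 0 < h_bm beta m x.
Proof. by move=> /median_C_bm_gt0 C0 x0; rewrite mulr_gt0 ?g_bm_gt0. Qed.

Lemma median_density_cdf xm : is_median beta m xm ->
  density_cdf (h_bm beta m) xm = 2^-1.
Proof.
move=> med; rewrite /density_cdf /Rintegral -integral_itv_bndo_bndc ?[X in fine X]med//.
apply/measurable_EFinP.
apply: measurable_funS (continuous_pos_measurable continuous_h_bm) => //.
by apply: subset_itvl; rewrite bnd_simp.
Qed.

Lemma median_D_bm_gt0 xm : is_median beta m xm -> 0 < D_bm beta m xm.
Proof.
by move=> med; rewrite invr_gt0 mulr_gt0 ?(median_h_bm_gt0 med)// (median_gt0 med).
Qed.

Lemma Eh_norm_powR_linear_weight (p a xm : R) (f : R -> R) :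
  0 <= a -> is_median beta m xm -> measurable_fun P f ->
  (Eh beta m (fun x => `|a * x * f x| `^ p)%R =
   (a `^ p)%:E * Eh beta m (fun x => x `^ p * `|f x| `^ p)%R)%E.
Proof.
move=> a0 med mf; rewrite /Eh -ge0_integral_pos_half_lineZl ?powR_ge0//.
- apply: eq_integral => x /set_mem; rewrite pos_half_lineE => x0.
  by rewrite norm_powRM_ge0 ?(ltW x0)// -mulrA.
- apply: measurable_funM.
    by apply: measurable_funM; [exact: measurable_funTS|exact: measurable_norm_powR].
  by apply: continuous_pos_measurable; exact: continuous_h_bm.
- move=> x /(median_h_bm_gt0 med)/ltW h0.
  by rewrite mulr_ge0// mulr_ge0 ?powR_ge0.
Qed.

Lemma poincare_h_bm (p xm : R) (phi dphi : R -> R) :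
  0 <= m -> is_median beta m xm -> 1 <= p ->
  (forall x, 0 < x -> is_derive x 1 phi (dphi x)) ->
  (forall x, 0 < x -> {for x, continuous dphi}) ->
  (Eh beta m (fun x => `|phi x| `^ p)%R < +oo)%E ->
  (Eh beta m (fun x => `|phi x - fine (Eh beta m phi)| `^ p)%R <=
   Eh beta m (fun x => `|p * D_bm beta m xm * x * dphi x| `^ p)%R)%E.
Proof.
move=> m0 med p1 dphiE dphi_cont phi_Lp; set D := D_bm beta m xm.
have xm0 := median_gt0 med; have D0 : 0 < D := median_D_bm_gt0 med.
have h_gt0 x : 0 < x -> 0 < h_bm beta m x := median_h_bm_gt0 med.
rewrite /Eh; under [leRHS]eq_integral => x _ do rewrite -[p * D * x]mulrA.
apply: (poincare_powR (xm := xm) (g := fun x => D * x)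
  (s := fun x => D * (1 - 2 * beta + m / x))) => //.
- by move=> x /h_gt0/ltW.
- exact: continuous_h_bm.
- exact: median_integral_h_bm med.
- by move=> x x0; rewrite ltW// mulr_gt0.
- by move=> x _; apply: continuousM; [exact: cvg_cst|exact: cvg_id].
- exact: is_derive_linear_mul_h_bm.
- move=> x y x0 xy; rewrite ler_pM2l// lerD2l ler_wpM2l// lef_pV2 ?posrE//.
  exact: lt_le_trans xy.
- exact: median_density_cdf.
- by rewrite /D /D_bm -mulrA mulVf// gt_eqF// mulr_gt0 ?h_gt0.
Qed.

End h_bm.

Theorem theorem4p3 (R : realType) (beta m xbar p : R) (phi : R -> R) :
  2^-1 < beta -> 0 < m -> is_median beta m xbar ->
  1 <= p -> smooth_pos phi ->
  (Eh beta m (fun x => (`|phi x| `^ p)%R) < +oo)%E ->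
  (Eh beta m (fun x => (`|phi x - fine (Eh beta m phi)| `^ p)%R) <=
   ((p * D_bm beta m xbar) `^ p)%R%:E *
   Eh beta m (fun x => (x `^ p * `|derive1 phi x| `^ p)%R))%E.
Proof.
move=> _ m0 med p1 phi_smooth phi_Lp.
have pD0 : 0 <= p * D_bm beta m xbar.
  by rewrite mulr_ge0 ?(le_trans ler01 p1)// ltW// (median_D_bm_gt0 med).
have dphiE (x : R) : 0 < x -> is_derive x 1 phi (derive1 phi x).
  by move=> /(phi_smooth 0%N)/derivableP; rewrite derive1E.
have dphi_cont (x : R) : 0 < x -> {for x, continuous (derive1 phi)}.
  by move=> /(phi_smooth 1%N) ?; exact/differentiable_continuous/derivable1_diffP.
rewrite -(Eh_norm_powR_linear_weight _ pD0 med).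
  exact: poincare_h_bm (ltW m0) med p1 dphiE dphi_cont phi_Lp.
exact: continuous_pos_measurable.
Qed.
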